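(* Let $n$ be a positive integer with $n\equiv 3\pmod 4$. Then the wheel graph $W_n$ satisfies $ced(W_n)=cvd(W_n)=1$.
   Context: Graphs are finite and may have multiple edges but not loops. A binary labeling of a graph $G$ is a function $f:V(G)\to\{0,1\}$. Two real numbers $x,y$ are roughly equal if $0\le |x-y|\le 1$. A binary labeling $f$ is friendly if $|f^{-1}(0)|$ and $|f^{-1}(1)|$ are roughly equal. A binary labeling $f$ induces an edge labeling $f_e:E(G)\to\{0,1\}$ by $f_e(uv)=f(u)+f(v)$ modulo 2. A friendly labeling $f$ of $G$ is cordial if $|f_e^{-1}(0)|$ and $|f_e^{-1}(1)|$ are roughly equal. The cordial edge deficiency $ced(G)$ is the minimum, over all friendly labelings $f$ of $G$, of the number of edges that must be added to $G$ between pairs of distinct vertices of $G$ (multiple edges allowed) so that $f$ becomes a cordial labeling of the augmented graph $G'$. The cordial vertex deficiency $cvd(G)$ is the minimum, over all binary labelings $f$ of $G$ (not necessarily friendly) for which $|f_e^{-1}(0)|$ and $|f_e^{-1}(1)|$ are roughly equal, of the number of labeled vertices (added as isolated vertices, with labels in $\{0,1\}$ chosen appropriately) that must be added to $G$ so that the resulting labeling of the augmented graph $G'$ is cordial; if no such binary labeling exists, $cvd(G)=\infty$. The wheel graph $W_n$ is obtained from the cycle $C_n$ by adding one further vertex (the central vertex) and joining it to each of the $n$ vertices of the cycle, so $W_n$ has $n+1$ vertices and $2n$ edges. *)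

(* Defs.v *)
From mathcomp Require Import all_boot all_order all_algebra.
From mathcomp Require Import boolp.

Set Implicit Arguments.
Unset Strict Implicit.
Unset Printing Implicit Defensive.

(* Multigraphs without loops: an edge is sent to its two-element set of        *)
(* endpoints, and distinct edges may have the same endpoints.                  *)
Record multigraph := Multigraph {
  vertex : finType;
  edge : finType;
  ends : edge -> {set vertex};
  card_ends : forall e, #|ends e| = 2
}.

(* The labels 0 and 1 are [false] and [true]; addition mod 2 is [addb].        *)
Definition labeling (G : multigraph) := vertex G -> bool.

Definition edge_label (G : multigraph) (f : labeling G) (e : edge G) : bool :=
  \big[addb/false]_(u in ends e) f u.

Definition roughly_equal (m n : nat) : bool := (`|m%:Z - n%:Z| <= 1)%R.

Definition friendly (G : multigraph) (f : labeling G) : bool :=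
  roughly_equal #|[set v | f v == false]| #|[set v | f v == true]|.

Definition edge_balanced (G : multigraph) (f : labeling G) : bool :=
  roughly_equal #|[set e | edge_label f e == false]|
                #|[set e | edge_label f e == true]|.

Definition cordial (G : multigraph) (f : labeling G) : bool :=
  friendly f && edge_balanced f.

Section Augmentation.

Variables (G : multigraph) (k : nat).

Definition add_edges_ends (a : 'I_k -> {set vertex G}) (x : edge G + 'I_k) :
    {set vertex G} :=
  match x with inl e => ends e | inr i => a i end.

Lemma card_add_edges_ends (a : 'I_k -> {set vertex G}) :
  (forall i, #|a i| = 2) -> forall x, #|add_edges_ends a x| = 2.
Proof. by move=> ha [e|i] /=; [apply: card_ends | apply: ha]. Qed.

Definition add_edges (a : 'I_k -> {set vertex G}) (ha : forall i, #|a i| = 2) :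
    multigraph :=
  Multigraph (card_add_edges_ends ha).

Definition add_vertices_ends (e : edge G) : {set vertex G + 'I_k} :=
  inl @: ends e.

Lemma card_add_vertices_ends (e : edge G) : #|add_vertices_ends e| = 2.
Proof. by rewrite card_imset ?card_ends // => u v []. Qed.

Definition add_vertices : multigraph := Multigraph card_add_vertices_ends.

Definition add_vertices_labeling (f : labeling G) (g : 'I_k -> bool) :
    labeling add_vertices :=
  fun x => match x with inl v => f v | inr i => g i end.

End Augmentation.

(* The least natural number satisfying P, [None] standing for infinity when    *)
(* there is none.                                                              *)
Definition minimum (P : nat -> Prop) : option nat :=
  match pselect (exists k, `[< P k >]) with
  | left exP => Some (ex_minn exP)
  | right _ => None
  end.

Lemma minimum_SomeP (P : nat -> Prop) (k : nat) :
  minimum P = Some k <-> P k /\ forall j, P j -> k <= j.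
Proof.
rewrite /minimum; case: pselect => [exP|nexP]; last first.
  by split=> // -[Pk _]; case: nexP; exists k; apply/asboolP.
case: ex_minnP => m /asboolP Pm minm; split=> [[<-]|[Pk mink]].
  by split=> // j Pj; apply: minm; apply/asboolP.
by congr Some; apply/eqP; rewrite eqn_leq mink // minm //; apply/asboolP.
Qed.

(* The new edges need not be distinct from one another or from old edges.      *)
Definition ced (G : multigraph) : option nat :=
  minimum (fun k => exists f : labeling G, friendly f /\
    exists (a : 'I_k -> {set vertex G}) (ha : forall i, #|a i| = 2),
      cordial (f : labeling (add_edges ha))).

Definition cvd (G : multigraph) : option nat :=
  minimum (fun k => exists f : labeling G, edge_balanced f /\
    exists g : 'I_k -> bool, cordial (add_vertices_labeling f g)).

Section Cycle.

Variable n : nat.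

(* The edge indexed by i joins i to its cyclic successor. The subtype only     *)
(* matters for n = 1, where it discards the loop; for n >= 2 it contains all   *)
(* the indices.                                                                *)
Definition cycle_edge := {i : 'I_n | ordS i != i}.

Definition cycle_ends (e : cycle_edge) : {set 'I_n} :=
  [set val e; ordS (val e)].

Lemma card_cycle_ends (e : cycle_edge) : #|cycle_ends e| = 2.
Proof. by rewrite cards2 eq_sym (valP e). Qed.

Definition cycle_graph : multigraph := Multigraph card_cycle_ends.

End Cycle.

(* The cone over G: one further vertex [None], and one edge joining it to each *)
(* vertex of G.                                                                *)
Section Cone.

Variable G : multigraph.

Definition cone_ends (x : edge G + vertex G) : {set option (vertex G)} :=
  match x with
  | inl e => Some @: ends e
  | inr v => [set None; Some v]
  end.

Lemma card_cone_ends (x : edge G + vertex G) : #|cone_ends x| = 2.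
Proof.
case: x => [e|v] /=; last by rewrite cards2.
by rewrite card_imset ?card_ends // => u v [].
Qed.

Definition cone : multigraph := Multigraph card_cone_ends.

End Cone.

Definition wheel (n : nat) : multigraph := cone (cycle_graph n).

(* Main.v *)
(* For n = 4m + 3 a friendly labeling of the wheel gives exactly 2m + 2 rim
   vertices a label different from that of the centre, and a cycle has an even
   number of edges labeled 1. So a friendly labeling has an even number of
   edges labeled 1, whereas edge balance would require 4m + 3 of the 8m + 6
   edges: the wheel is not cordial. *)
Require Import Defs.
From mathcomp Require Import all_boot.
From mathcomp Require Import zify.

Set Implicit Arguments.
Unset Strict Implicit.
Unset Printing Implicit Defensive.

Lemma roughly_equalE (m n : nat) :
  roughly_equal m n = (m <= n.+1) && (n <= m.+1).
Proof. rewrite /roughly_equal; lia. Qed.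

Lemma odd_sum_bool (T : finType) (p : T -> bool) :
  odd (\sum_x p x) = \big[addb/false]_x p x.
Proof.
by rewrite (big_morph odd oddD (erefl _)); apply: eq_bigr => x _; rewrite oddb.
Qed.

Lemma sum_negb (T : finType) (p : T -> bool) :
  \sum_x ~~ p x + \sum_x p x = #|T|.
Proof.
rewrite -big_split /= -sum1_card; apply: eq_bigr => x _.
by case: (p x).
Qed.

Lemma sum_option (T : finType) (F : option T -> nat) :
  \sum_x F x = F None + \sum_x F (Some x).
Proof.
rewrite (bigD1 None) //=; congr (_ + _).
rewrite (reindex_omap Some id) /=; last by case.
by apply: eq_bigl => x; rewrite eqxx.
Qed.

(** Turns friendliness and edge balance alike into linear inequalities on a single count of ones,
    ready for [lia]. *)
Lemma roughly_equal_fibers (T : finType) (p : T -> bool) :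
  roughly_equal #|[set x | p x == false]| #|[set x | p x == true]| =
    ((\sum_x p x).*2 <= #|T|.+1) && (#|T| <= (\sum_x p x).*2.+1).
Proof.
have -> : #|[set x | p x == false]| = \sum_x ~~ p x.
  rewrite -sum1dep_card big_mkcond; apply: eq_bigr => x _.
  by case: (p x).
have -> : #|[set x | p x == true]| = \sum_x p x.
  rewrite -sum1dep_card big_mkcond; apply: eq_bigr => x _.
  by case: (p x).
by have := sum_negb p; rewrite roughly_equalE; lia.
Qed.

Lemma edge_label_pair (G : multigraph) (f : labeling G) (e : edge G) u v :
  ends e = [set u; v] -> u != v -> edge_label f e = f u (+) f v.
Proof.
move=> eE neq_uv; rewrite /edge_label eE big_setU1 ?big_set1 //.
by rewrite inE.
Qed.

(** Serves both embeddings of old edges: rim edges into the cone, and all edges into the graph with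
    added vertices. *)
Lemma edge_label_imset (G H : multigraph) (h : vertex G -> vertex H)
    (f : labeling H) (e : edge G) (e' : edge H) :
  injective h -> ends e' = h @: ends e ->
  edge_label f e' = edge_label (G := G) (f \o h) e.
Proof. by move=> h_inj; rewrite /edge_label => ->; rewrite big_imset //; apply: in2W. Qed.

Definition cut (G : multigraph) (f : labeling G) := \sum_e edge_label f e.

Lemma cut_add_edges (G : multigraph) (f : labeling G) k
    (a : 'I_k -> {set vertex G}) (ha : forall i, #|a i| = 2) :
  cut (f : labeling (add_edges ha)) =
    cut f + \sum_i \big[addb/false]_(u in a i) f u.
Proof. by rewrite /cut big_sumType. Qed.

Lemma cut_add_vertices (G : multigraph) (f : labeling G) k (g : 'I_k -> bool) :
  cut (add_vertices_labeling f g) = cut f.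
Proof.
apply: eq_bigr => e _.
by rewrite (@edge_label_imset G (add_vertices G k) inl _ e) // => u v [].
Qed.

Lemma cut_cone (G : multigraph) (f : labeling (cone G)) :
  cut f = cut (f \o Some : labeling G) + \sum_v (f None (+) f (Some v)).
Proof.
rewrite /cut big_sumType; congr (_ + _); apply: eq_bigr => x _.
  by rewrite (@edge_label_imset G (cone G) Some _ x) // => u v [].
by rewrite (@edge_label_pair _ f (inr x) None (Some x)).
Qed.

Lemma cut_cycle n (f : labeling (cycle_graph n)) :
  cut f = \sum_(i < n) (f i (+) f (ordS i)).
Proof.
(* Indices outside the subtype would be loops, whose two equal end labels cancel. *)
rewrite (bigID (fun i : 'I_n => ordS i != i)) /= [X in _ + X]big1 ?addn0.
  rewrite (big_sub (fun i : 'I_n => ordS i != i) (fun i => _ : nat)).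
  apply: eq_bigr => e _; rewrite (@edge_label_pair _ f e (val e) (ordS (val e))) //.
  by rewrite eq_sym (valP e).
by move=> i; rewrite negbK => /eqP ->; rewrite addbb.
Qed.

(** Since [ordS] is a permutation, each vertex label enters twice, once from each incident edge, and
    cancels modulo 2. *)
Lemma odd_cut_cycle n (f : labeling (cycle_graph n)) : ~~ odd (cut f).
Proof.
rewrite cut_cycle odd_sum_bool big_split /= [X in _ (+) X](_ : _ = \big[addb/false]_i f i).
  by rewrite addbb.
by rewrite [RHS](reindex_inj (@ordS_inj n)).
Qed.

Lemma card_edge_cycle n : 1 < n -> #|edge (cycle_graph n)| = n.
Proof.
move=> n_gt1; rewrite card_sig -[RHS]card_ord; apply: eq_card => i.
rewrite !inE; apply/eqP => /(congr1 val) /=.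
have := ltn_ord i; rewrite leq_eqVlt => /orP[/eqP iE|lt_in].
  by rewrite iE modnn; lia.
by rewrite modn_small; lia.
Qed.

Lemma card_vertex_wheel n : #|vertex (wheel n)| = n.+1.
Proof. by rewrite card_option card_ord. Qed.

Lemma card_edge_wheel n : 1 < n -> #|edge (wheel n)| = n.*2.
Proof.
by move=> n_gt1; rewrite card_sum (card_edge_cycle n_gt1) card_ord addnn.
Qed.

Lemma cut_wheel_friendly_even m (f : labeling (wheel (4 * m + 3))) :
  friendly f -> ~~ odd (cut f).
Proof.
rewrite /friendly roughly_equal_fibers card_vertex_wheel sum_option.
rewrite cut_cone oddD (negbTE (odd_cut_cycle _)) addFb.
have := sum_negb (fun i : 'I_(4 * m + 3) => f (Some i)); rewrite card_ord.
set S1 := \sum_i f (Some i); set S0 := \sum_i ~~ f (Some i).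
(* The number of vertices, 4m + 4, is even, so friendliness forces 2m + 2 of each label. The spokes
   labeled 1 end at the class avoiding the centre, which lies wholly on the rim. *)
case: (f None) => /=; rewrite -/S0 -/S1; move: S0 S1; lia.
Qed.

(* Runs of length two around the rim give 2m + 2 label changes, the one at
   the closing edge included. *)
Definition wheel_labeling (b : bool) n : labeling (wheel n) :=
  fun x => if x is Some i then b (+) (i %% 4 < 2) else false.


Lemma sum_modn4_lt2 m : \sum_(i < 4 * m + 3) (i %% 4 < 2) = 2 * m + 2.
Proof.
rewrite -(big_mkord xpredT (fun i => (i %% 4 < 2) : nat)).
elim: m => [|m IHm]; first by rewrite /index_iota unlock.
rewrite (_ : 4 * m.+1 + 3 = (4 * m + 3).+4); last by lia.
by rewrite !big_nat_recr //= IHm; lia.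
Qed.

Lemma sum_odd m : \sum_(i < (4 * m).+2) odd i = 2 * m + 1.
Proof.
rewrite -(big_mkord xpredT (fun i => odd i : nat)).
elim: m => [|m IHm]; first by rewrite /index_iota unlock.
rewrite (_ : (4 * m.+1).+2 = (4 * m).+2.+4); last by lia.
by rewrite 4?big_nat_recr //= IHm; lia.
Qed.

Lemma cut_rim b m :
  cut (@wheel_labeling b (4 * m + 3) \o Some : labeling (cycle_graph _)) =
    2 * m + 2.
Proof.
rewrite cut_cycle addn3 big_ord_recr /= modnn.
(* The split-off closing edge goes from residue 2 to residue 0, a label change. Elsewhere the label
   changes from i to i + 1 exactly for odd i. The shift by [b] cancels on every edge. *)
rewrite [X in X + _](_ : _ = 2 * m + 1); first by case: b; lia.
rewrite -sum_odd; apply: eq_bigr => i _.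
by rewrite [_.+1 %% (4 * m).+3]modn_small; have := ltn_ord i; case: b; lia.
Qed.

Lemma sum_rim b m :
  \sum_i @wheel_labeling b (4 * m + 3) (Some i) = 2 * m + 2 - b.
Proof.
have := sum_negb (fun i : 'I_(4 * m + 3) => i %% 4 < 2).
rewrite sum_modn4_lt2 card_ord; case: b => [sumE|_]; last first.
  by rewrite subn0 -sum_modn4_lt2.
have -> : 2 * m + 2 - true = 2 * m + 1 by lia.
by apply: (@addIn (2 * m + 2)); rewrite [LHS]sumE; lia.
Qed.

(** The centre has label 0, so the spokes labeled 1 number as many as the rim ones. For [b = false]
    the labeling is friendly but has one edge labeled 1 above half of 8m + 6; for [b = true] the
    edges balance exactly, but only 2m + 1 of the 4m + 4 vertices have label 1. *)
Lemma cut_wheel_labeling b m :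
  cut (@wheel_labeling b (4 * m + 3)) = 4 * m + 4 - b.
Proof. by rewrite cut_cone cut_rim [X in _ + X]sum_rim; case: b; lia. Qed.

Lemma ced_wheel m : ced (wheel (4 * m + 3)) = Some 1.
Proof.
apply/minimum_SomeP; split=> [|[|//] [f [f_friendly [a [ha]]]]]; last first.
  (* With no edge added, balance would force the odd cut 4m + 3. *)
  case/andP=> _; rewrite /edge_balanced roughly_equal_fibers -/(cut _).
  rewrite cut_add_edges big_ord0 addn0 card_sum card_ord card_edge_wheel; last by lia.
  by have := cut_wheel_friendly_even f_friendly; lia.
pose f := @wheel_labeling false (4 * m + 3).
have f_friendly : friendly f.
  rewrite /friendly roughly_equal_fibers card_vertex_wheel sum_option sum_rim /=.
  by lia.
have lt0 : 0 < 4 * m + 3 by lia.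
have lt1 : 1 < 4 * m + 3 by lia.
(* Rim vertices 0 and 1 share a run, so the new edge gets label 0 and the counts become 4m + 3 and
   4m + 4. *)
pose u : vertex (wheel (4 * m + 3)) := Some (Ordinal lt0).
pose v : vertex (wheel (4 * m + 3)) := Some (Ordinal lt1).
exists f; split=> //; exists (fun=> [set u; v]).
have ha (i : 'I_1) : #|[set u; v]| = 2 by rewrite cards2.
exists ha; apply/andP; split=> //.
rewrite /edge_balanced roughly_equal_fibers -/(cut _) cut_add_edges.
rewrite cut_wheel_labeling big_ord1 big_setU1 ?inE // big_set1 /=.
by rewrite card_sum card_ord card_edge_wheel //; lia.
Qed.

Lemma cvd_wheel m : cvd (wheel (4 * m + 3)) = Some 1.
Proof.
apply/minimum_SomeP; split=> [|[|//] [f [f_balanced [g]]]]; last first.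
  case/andP=> fr _.
  have /cut_wheel_friendly_even : friendly f.
    move: fr; rewrite /friendly !roughly_equal_fibers big_sumType /= big_ord0.
    by rewrite card_sum card_ord !addn0.
  move: f_balanced; rewrite /edge_balanced roughly_equal_fibers -/(cut _).
  by rewrite card_edge_wheel; lia.
pose f := @wheel_labeling true (4 * m + 3).
have f_balanced : edge_balanced f.
  rewrite /edge_balanced roughly_equal_fibers -/(cut _) cut_wheel_labeling.
  by rewrite card_edge_wheel; lia.
(* A new vertex labeled 1 changes 2m + 1 ones against 2m + 3 zeros into 2m + 2 against 2m + 3; being
   isolated, it keeps the edge balance. *)
exists f; split=> //; exists (fun=> true); apply/andP; split.
  rewrite /friendly roughly_equal_fibers big_sumType /= sum_option sum_rim /=.
  by rewrite big_ord1 card_sum card_ord card_vertex_wheel; lia.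
move: f_balanced; rewrite /edge_balanced !roughly_equal_fibers -!/(cut _).
by rewrite cut_add_vertices.
Qed.

Theorem theorem6 (n : nat) (n_gt0 : 0 < n) (n_mod4 : n = 3 %[mod 4]) :
  ced (wheel n) = Some 1 /\ cvd (wheel n) = Some 1.
Proof.
have -> : n = 4 * (n %/ 4) + 3 by have := divn_eq n 4; rewrite n_mod4; lia.
by split; [exact: ced_wheel | exact: cvd_wheel].
Qed.
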